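(* Let $(X,r)$ be a solution with diagonal map $T$, let $k$ be a positive integer, and let $(X,r^{(k)})$ be the $k$-cabled solution. (1) The diagonal map of $(X,r^{(k)})$ is $T^k$. (2) Let $x\in X$ lie in a $\mathcal{G}(X,r)$-orbit of size $m$ and in a $\mathcal{G}(X,r^{(k)})$-orbit of size $m'$. Then $m'$ is a multiple of $m_k$, where $m_k$ denotes the maximal divisor of $m$ which is coprime to $k$ (that is, $m_k\mid m$, $\gcd(m_k,k)=1$, and $m_k$ is the largest such integer).
   Context: A solution $(X,r)$ is a non-empty finite set $X$, with $|X|>1$, together with an involutive map $r\colon X\times X\to X\times X$, $r(x,y)=(\sigma_x(y),\tau_y(x))$, satisfying $r_1r_2r_1=r_2r_1r_2$ on $X^3$, where $r_1=r\times \mathrm{Id}_X$ and $r_2=\mathrm{Id}_X\times r$, and such that all maps $\sigma_x$ and $\tau_x$ ($x\in X$) are bijections of $X$. Its permutation group $\mathcal{G}(X,r)$ is the group of permutations of $X$ generated by all $\sigma_x$, $x\in X$. Its diagonal map is the permutation $T\colon X\to X$, $T(x)=\tau_x^{-1}(x)$; its inverse is $U(x)=\sigma_x^{-1}(x)$. Cabling. The structure group $G=G(X,r)=\langle X\mid xy=\sigma_x(y)\tau_y(x)\text{ for all }x,y\in X\rangle$ carries a commutative group operation $+$ satisfying $a(b+c)=ab-a+ac$, with $x+y=x\,\sigma_x^{-1}(y)$ for $x,y\in X$, and such that $(G,+)$ is free abelian with basis $X$. The map $r$ extends to the solution $R(a,b)=(\lambda_a(b),\lambda_a(b)^{-1}ab)$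 on $G$, where $\lambda_a(b)=-a+ab$. For a positive integer $k$ the map $\iota^{(k)}\colon X\to G$, $x\mapsto kx=x+\cdots+x$ ($k$ summands), is injective and its image is a sub-solution of $(G,R)$; the $k$-cabled solution $r^{(k)}$ on $X$ is the pull-back of $R$ through $\iota^{(k)}$. Explicitly, $$r^{(k)}(x,y)=(\sigma_{kx}(y),\,T^{k-1}\tau_{ky}T^{-k+1}(x)),$$ where $\sigma_{kx}=\sigma_x\sigma_{U(x)}\cdots\sigma_{U^{k-1}(x)}$ and $\tau_{ky}=\tau_{U^{k-1}(y)}\cdots\tau_{U(y)}\tau_y$ (compositions of maps, rightmost applied first). *)

(* Defs.v *)
From mathcomp Require Import all_boot all_order all_algebra all_fingroup.

Set Implicit Arguments.
Unset Strict Implicit.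
Unset Printing Implicit Defensive.

Import GRing.Theory.

Section Solutions.
Variables (X : finType) (r : X * X -> X * X).

(* r (x, y) = (sigma x y, tau y x) *)
Definition sigma (x y : X) : X := (r (x, y)).1.
Definition tau (y x : X) : X := (r (x, y)).2.

Definition r1 (t : X * X * X) : X * X * X :=
  let: (x, y, z) := t in let: (x', y') := r (x, y) in (x', y', z).
Definition r2 (t : X * X * X) : X * X * X :=
  let: (x, y, z) := t in let: (y', z') := r (y, z) in (x, y', z').

Record is_solution : Prop := IsSolution {
  solution_card : 1 < #|X|;
  solution_invol : involutive r;
  solution_braid : r1 \o r2 \o r1 =1 r2 \o r1 \o r2;
  solution_sigma : forall x, bijective (sigma x);
  solution_tau : forall x, bijective (tau x) }.

(* [finv f] is the inverse of f whenever f is injective. *)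
Definition diagT (x : X) : X := finv (tau x) x.
Definition diagU (x : X) : X := finv (sigma x) x.

(* Generated by all permutations that coincide with some sigma_x. *)
Definition perm_group : {group {perm X}} :=
  <<[set s : {perm X} | [exists x, forall y, s y == sigma x y]]>>%G.

(* sigma_{kx} = sigma_x sigma_{U x} ... sigma_{U^(k-1) x} and
   tau_{ky} = tau_{U^(k-1) y} ... tau_{U y} tau_y. *)
Definition sigmak (k : nat) (x y : X) : X :=
  foldr sigma y (traject diagU x k).
Definition tauk (k : nat) (y x : X) : X :=
  foldl (fun v u => tau u v) x (traject diagU y k).

(* The k-cabled solution, for k > 0; T^(-k+1) is written U^(k-1), see
   [diagTK] and [diagUK]. [cabled_pullback] identifies it with the pull-back
   through x |-> kx of the solution on the structure group. *)
Definition cabled (k : nat) (p : X * X) : X * X :=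
  (sigmak k p.1 p.2,
   iter k.-1 diagT (tauk k p.2 (iter k.-1 diagU p.1))).

End Solutions.

(* The largest divisor of m that is coprime to k. *)
Definition max_coprime_divisor (m k : nat) : nat :=
  \max_(d <- divisors m | coprime d k) d.

Lemma iter_cancel (T : Type) (f g : T -> T) n :
  cancel f g -> cancel (iter n f) (iter n g).
Proof. by move=> fK; elim: n => [//|n IH] x; rewrite iterSr iterS fK IH. Qed.

Section Basics.
Variables (X : finType) (r : X * X -> X * X).
Hypothesis hr : is_solution r.

Let sigma_inj x : injective (sigma r x).
Proof. exact: bij_inj (solution_sigma hr x). Qed.
Let tau_inj x : injective (tau r x).
Proof. exact: bij_inj (solution_tau hr x). Qed.

Lemma sigma_tau x y : sigma r (sigma r x y) (tau r y x) = x.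
Proof.
by rewrite /sigma /tau -surjective_pairing (solution_invol hr).
Qed.

Lemma tau_sigma x y : tau r (tau r y x) (sigma r x y) = y.
Proof.
by rewrite /sigma /tau -surjective_pairing (solution_invol hr).
Qed.

Lemma sigma_diagU x : sigma r x (diagU r x) = x.
Proof. exact: f_finv. Qed.

Lemma tau_diagT x : tau r x (diagT r x) = x.
Proof. exact: f_finv. Qed.

Lemma diagTK : cancel (diagT r) (diagU r).
Proof.
move=> x; apply: (@sigma_inj (diagT r x)); rewrite sigma_diagU.
apply: (@tau_inj x); rewrite tau_diagT.
by have := tau_sigma (diagT r x) x; rewrite tau_diagT.
Qed.

Lemma diagUK : cancel (diagU r) (diagT r).
Proof.
move=> x; have [g gK Kg] := injF_bij (can_inj diagTK).
by rewrite -(Kg x) diagTK.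
Qed.

Lemma sigmak_inj k x : injective (sigmak r k x).
Proof.
by rewrite /sigmak => y z; elim: k x => [|k IH] x //= /sigma_inj /IH.
Qed.

Lemma tauk_inj k y : injective (tauk r k y).
Proof.
by rewrite /tauk; elim: k y => [|k IH] y u v //= /IH /tau_inj.
Qed.

Lemma cabled_sigma_bij k x : bijective (sigma (cabled r k) x).
Proof. by apply: injF_bij => y z /sigmak_inj. Qed.

Lemma cabled_tau_bij k y : bijective (tau (cabled r k) y).
Proof.
apply: injF_bij => u v; rewrite /tau /= => /(can_inj (iter_cancel k.-1 diagTK)).
by move=> /tauk_inj /(can_inj (iter_cancel k.-1 diagUK)).
Qed.

End Basics.

Section PullBack.
Local Open Scope ring_scope.

(* G with a second group law mul, linked by a(b+c) = ab - a + ac. *)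
Record is_brace (G : zmodType) (mul : G -> G -> G) (one : G) (inv : G -> G)
    : Prop := IsBrace {
  brace_mulA : associative mul;
  brace_mul1 : left_id one mul;
  brace_mulV : left_inverse one inv mul;
  brace_dist : forall a b c, mul a (b + c) = mul a b - a + mul a c }.

Definition lam (G : zmodType) (mul : G -> G -> G) (a b : G) : G :=
  - a + mul a b.

(* R(a, b) = (lam_a b, (lam_a b)^-1 a b) *)
Definition brace_sol (G : zmodType) (mul : G -> G -> G) (inv : G -> G)
    (p : G * G) : G * G :=
  (lam mul p.1 p.2, mul (inv (lam mul p.1 p.2)) (mul p.1 p.2)).

Variables (G : zmodType) (mul : G -> G -> G) (one : G) (inv : G -> G).
Hypothesis hG : is_brace mul one inv.
Local Notation "a ** b" := (mul a b) (at level 40, left associativity).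
Local Notation L := (lam mul).

Let mulE a b : a ** b = a + L a b.
Proof. by rewrite /lam addNKr. Qed.

Let lamD a b c : L a (b + c) = L a b + L a c.
Proof. by rewrite /lam (brace_dist hG) -!addrA. Qed.

Let lam0 a : L a 0 = 0.
Proof. by apply: (@addrI _ (L a 0)); rewrite -lamD !addr0. Qed.

Let lamMn a b n : L a (b *+ n) = L a b *+ n.
Proof. by elim: n => [|n IH]; rewrite ?mulr0n ?lam0 // !mulrS lamD IH. Qed.

Let lamM a b c : L (a ** b) c = L a (L b c).
Proof.
apply: (@addrI _ (a ** b)).
by rewrite -mulE -(brace_mulA hG) {1}(mulE a b) -addrA -lamD -!mulE.
Qed.

Let one0 : one = 0.
Proof. by rewrite -[RHS](brace_mul1 hG) mulE lam0 addr0. Qed.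

Let lam_id c : L 0 c = c.
Proof. by rewrite -{1}one0 /lam (brace_mul1 hG) one0 oppr0 add0r. Qed.

Let lamK a : cancel (L a) (L (inv a)).
Proof. by move=> b; rewrite -lamM (brace_mulV hG) one0 lam_id. Qed.

Variables (X : finType) (r : X * X -> X * X) (i : X -> G).
Hypothesis hr : is_solution r.
Hypothesis i_add : forall x y, i x + i y = i x ** i (finv (sigma r x) y).
Hypothesis i_inj :
  forall k, (0 < k)%N -> injective (fun x => i x *+ k).

Let sigma_inj x : injective (sigma r x).
Proof. exact: bij_inj (solution_sigma hr x). Qed.

Let i_inj1 : injective i.
Proof. by move=> x y e; apply: (@i_inj 1); rewrite ?mulr1n. Qed.

Let lam_i x y : L (i x) (i y) = i (sigma r x y).
Proof.
apply: (@addrI _ (i x)); rewrite -mulE i_add finv_f //; exact: sigma_inj.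
Qed.

Let mulrnS_i x n : i x *+ n.+1 = i x ** (i (diagU r x) *+ n).
Proof. by rewrite mulE lamMn lam_i sigma_diagU // mulrS. Qed.

Let lam_ik k x y : L (i x *+ k) (i y) = i (sigmak r k x y).
Proof.
rewrite /sigmak; elim: k x => [|k IH] x; first by rewrite lam_id.
by rewrite mulrnS_i lamM IH lam_i.
Qed.

Let lam_iU n x : L (i x *+ n) (i (iter n (diagU r) x)) = i x.
Proof.
elim: n x => [|n IH] x; first by rewrite lam_id.
by rewrite mulrnS_i lamM iterSr IH lam_i sigma_diagU.
Qed.

Let lam_tauk k y v : L (L (i v) (i y *+ k)) (i (tauk r k y v)) = i v.
Proof.
rewrite /tauk; elim: k y v => [|k IH] y v; first by rewrite lam0 lam_id.
have e : L (i v) (i y *+ k.+1) =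
    i (sigma r v y) ** L (i (tau r y v)) (i (diagU r y) *+ k).
  rewrite mulrnS_i mulE lamD -lamM lam_i [RHS]mulE -lamM; congr (_ + L _ _).
  by rewrite !mulE !lam_i sigma_tau // addrC.
by rewrite e lamM /= IH lam_i sigma_tau.
Qed.

(* For G the structure group of (X, r), i : X -> G has the two required
   properties because (G, +) is free abelian with basis X and
   x + y = x sigma_x^-1(y). Hence [cabled r k] is the unique map on X * X that
   corresponds to the solution [brace_sol] of G under x |-> kx. *)
Lemma cabled_pullback k x y p : (0 < k)%N ->
  (p = cabled r k (x, y)) <->
  ((i p.1 *+ k, i p.2 *+ k) = brace_sol mul inv (i x *+ k, i y *+ k)).
Proof.
move=> k_gt0.
suff main : (i (cabled r k (x, y)).1 *+ k, i (cabled r k (x, y)).2 *+ k)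
    = brace_sol mul inv (i x *+ k, i y *+ k).
  split=> [-> //|]; rewrite -main => -[/(i_inj k_gt0) e1 /(i_inj k_gt0) e2].
  by rewrite [p]surjective_pairing e1 e2.
rewrite /brace_sol /=; set a := i x *+ k; set b := i y *+ k.
have Eab : L a b = i (sigmak r k x y) *+ k by rewrite /b lamMn lam_ik.
congr (_, _); first by [].
set c := L a b; set z := iter _ _ _.
have invK u : inv c ** (c ** u) = u.
  by rewrite (brace_mulA hG) (brace_mulV hG) (brace_mul1 hG).
suff Hz : L c (i z) = i x.
  by rewrite -[LHS]invK; congr (_ ** _); rewrite !mulE lamMn Hz addrC.
have [g _ Kg] := injF_bij (@sigmak_inj _ _ hr k (sigmak r k x y)).
pose z' := g x.
have Hz' : L c (i z') = i x by rewrite /c Eab lam_ik Kg.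
suff -> : z = z' by [].
rewrite /z; set n := k.-1; set u := iter n (diagU r) x.
have Ek : k = n.+1 by rewrite prednK.
suff -> : tauk r k y u = iter n (diagU r) z' by rewrite (iter_cancel n (diagUK hr)).
apply: i_inj1; set d := c + i x *+ n.
have Ed1 : d = c ** (i z' *+ n) by rewrite mulE lamMn Hz'.
have Ed2 : d = (i x *+ n) ** L (i u) b.
  by rewrite /d addrC mulE -lamM [_ ** i u]mulE lam_iU -mulrSr -Ek.
apply: (can_inj (lamK d)).
rewrite {1}Ed2 Ed1 !lamM lam_iU Hz' /b /tauk.
by have := lam_tauk k y u; rewrite /tauk => ->; rewrite lam_iU.
Qed.

End PullBack.

(* Main.v *)
Require Import Defs.
From mathcomp Require Import all_boot all_order all_algebra all_fingroup.
From mathcomp Require Import all_solvable.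

(** Write G for the permutation group of r and H for that of the cabled
    solution.  Everything in the second claim follows from one fact: H is a
    subgroup of G whose index only has prime divisors of k.  Granted this, for
    stabilisers G_x and H_x of x, the orbit size m = |G : G_x| divides
    |G : H_x| = |G : H| m', and m_k, being coprime to |G : H|, divides m'.

    The index is usually bounded through the brace structure of G: its additive
    group is abelian, H is the image of multiplication by k, and G / kG has
    exponent dividing k.  Here the additive group is replaced by a group of
    permutations of the set of all permutations of X.  Adding the generator x
    to p in the brace amounts to
      p |-> p sigma_(p^-1 x),
    which makes sense for every permutation p of X.  These translations are
    bijective and commute with one another (lemma [translation_comm], where the
    braid relation enters), so they generate an abelian group A.  The orbit of 1
    under A is G, and since the k-th power of translation by x is
      p |-> p sigma_(k p^-1 x)
    ([translation_exp]), the orbit of 1 under the subgroup B generated by these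
    powers is H (lemma [orbit_translations], used twice).  As A / B is abelian
    and generated by elements of order dividing k, |A : B| is a product of
    primes dividing k, and comparing the stabilisers of 1 in A and in B shows
    that |G : H| divides |A : B| ([orbit_index_dvdn]).

    The first claim is a telescoping computation: in
    tau_(U^(k-1) x) ... tau_(U x) tau_x applied to T x, each factor turns
    T (U^i x) into U^i x, which is T (U^(i+1) x). *)

Set Implicit Arguments.
Unset Strict Implicit.
Unset Printing Implicit Defensive.

Local Open Scope group_scope.

(** * Divisibility of group indices *)

Lemma max_coprime_divisorP m k : 0 < m ->
  (max_coprime_divisor m k %| m) && coprime (max_coprime_divisor m k) k.
Proof.
move=> m_gt0; rewrite /max_coprime_divisor.
set M := \max_(_ <- _ | _) _.
have M_gt0 : 0 < M.
  apply: (leq_trans _ (leq_bigmax_seq (F := fun d => d) 1%N _ _)) => //.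
    by rewrite -dvdn_divisors.
  exact: coprime1n.
have [M0|//] : M = 0 \/ (M %| m) && coprime M k; last by rewrite M0 in M_gt0.
rewrite /M big_seq_cond; elim/big_ind: _ => [|a b IHa IHb|d /andP[]].
- by left.
- by rewrite /maxn; case: ifP.
- by rewrite -dvdn_divisors // => -> ->; right.
Qed.

(** The quotient is abelian and generated by elements of order dividing k, so
    its exponent divides k. *)
Lemma pnat_index_exp (gT : finGroupType) (I : finType) (g : I -> gT) k :
    0 < k -> abelian <<[set g i | i : I]>> ->
  \pi(k).-nat #|<<[set g i | i : I]>> : <<[set g i ^+ k | i : I]>>|.
Proof.
move=> k_gt0; set A := <<_>>; set B := <<_>> => cAA.
have sBA : B \subset A.
  rewrite gen_subG; apply/subsetP=> _ /imsetP[i _ ->].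
  by rewrite groupX ?mem_gen ?imset_f.
have nBA : A \subset 'N(B) := sub_abelian_norm cAA sBA.
have nBg i : g i \in 'N(B) by rewrite (subsetP nBA) ?mem_gen ?imset_f.
rewrite -card_quotient //.
change (\pi(k).-group (A / B)); rewrite -pnat_exponent.
have cBAA : abelian (A / B) := quotient_abelian B cAA.
have AB_gen : A / B = <<[set g i | i : I] / B>>.
  rewrite /A quotient_gen //.
  by apply/subsetP=> _ /imsetP[i _ ->].
apply: (@pnat_dvd _ k); last by rewrite /= pnat_pi.
rewrite [exponent _]/= -/A -/B AB_gen.
rewrite abelian_exponent_gen ?(abelianS _ cBAA) //; last first.
  by rewrite AB_gen subset_gen.
apply/exponentP=> _ /morphimP[_ _ /imsetP[i _ ->] ->].
rewrite -morphX //; apply: coset_id.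
by apply/mem_gen/imsetP; exists i.
Qed.

(** The missing factor |A : B| / n is the index of the stabiliser of x in B
    inside its stabiliser in A. *)
Lemma orbit_index_dvdn (aT : finGroupType) (T : finType)
    (to : {action aT &-> T}) (A B : {group aT}) (x : T) (n : nat) :
    B \subset A -> #|orbit to A x| = (n * #|orbit to B x|)%N -> n %| #|A : B|.
Proof.
move=> sBA oA.
have sS : 'C_B[x | to] \subset 'C_A[x | to] by rewrite setSI.
apply/dvdnP; exists #|'C_A[x | to] : 'C_B[x | to]|.
apply/eqP; rewrite -(eqn_pmul2l (cardG_gt0 B)) Lagrange //; apply/eqP.
rewrite -(card_orbit_stab to A x) oA -(Lagrange sS).
by rewrite -(card_orbit_stab to B x) (mulnC n) mulnACA (mulnC n).
Qed.

Lemma dvdn_orbit_index (aT : finGroupType) (T : finType)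
    (to : {action aT &-> T}) (G H : {group aT}) (x : T) :
    H \subset G -> #|orbit to G x| %| #|G : H| * #|orbit to H x|.
Proof.
move=> sHG; rewrite !card_orbit -[H :&: _]/('C_H[x | to]).
rewrite Lagrange_index ?subsetIl //.
by rewrite -(@Lagrange_index _ _ 'C_G[x | to]) ?subsetIl ?setSI // dvdn_mulr.
Qed.

(** * Translations by elements of X *)

Section Translations.
Variable X : finType.

(** The orbit is stable under left multiplication by each f y, because
    f y * p is the image of p under the translation S (p y). *)
Lemma orbit_translations (f : X -> {perm X}) (S : X -> {perm {perm X}}) :
    (forall x p, S x p = f (p^-1 x) * p) ->
  orbit 'P <<[set S x | x : X]>> 1 = <<[set f x | x : X]>>.
Proof.
move=> SE; set A := <<_>>; set G := <<_>>.
have SA x : S x \in A by rewrite mem_gen ?imset_f.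
have fG x : f x \in G by rewrite mem_gen ?imset_f.
apply/eqP; rewrite eqEsubset; apply/andP; split.
  have actsG : [acts A, on G | 'P].
    rewrite gen_subG; apply/subsetP=> _ /imsetP[x _ ->].
    rewrite !inE; apply/subsetP=> p Gp.
    by rewrite inE /= apermE SE groupM.
  by rewrite (acts_sub_orbit 1 actsG) group1.
pose stab := [set g | [forall p in orbit 'P A 1, g * p \in orbit 'P A 1]].
have stabP g : reflect (forall p, p \in orbit 'P A 1 -> g * p \in orbit 'P A 1)
    (g \in stab).
  by rewrite inE; apply: 'forall_implyP.
have stab_group : group_set stab.
  apply/group_setP; split=> [|g h /stabP sg /stabP sh].
    by apply/stabP=> p; rewrite mul1g.
  by apply/stabP=> p Op; rewrite -mulgA sg ?sh.
have : G \subset Group stab_group.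
  rewrite gen_subG; apply/subsetP=> _ /imsetP[y _ ->].
  apply/stabP=> p Op; rewrite -[in f y](permK p y) -SE.
  exact: orbit_trans (mem_orbit _ _ (SA (p y))) Op.
move=> /subsetP sG; apply/subsetP=> g /sG /stabP/(_ 1).
by rewrite mulg1; apply; apply: orbit_refl.
Qed.
End Translations.

Section Solution.
Variables (X : finType) (r : X * X -> X * X).
Hypothesis hr : is_solution r.

Let sigma_inj x : injective (sigma r x).
Proof. exact: bij_inj (solution_sigma hr x). Qed.

Lemma sigma_braid x y z :
  sigma r x (sigma r y z) = sigma r (sigma r x y) (sigma r (tau r y x) z).
Proof.
have := solution_braid hr (x, y, z).
by rewrite /= /sigma /tau; do !case: (r _) => ? ? /=; case.
Qed.

Definition sigma_perm x : {perm X} := perm (@sigma_inj x).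
Definition sigmak_perm k x : {perm X} := perm (@sigmak_inj _ _ hr k x).

(** The composite p sigma_(p^-1 x), that is, the brace sum of p and x; the
    factors are swapped because the product of permutations applies its left
    factor first. *)
Definition translate x (p : {perm X}) : {perm X} := sigma_perm (p^-1 x) * p.

(** With q the translate of p by x, q maps U (p^-1 x) to x; hence p^-1 x is
    T (q^-1 x) and p can be recovered from q. *)
Lemma translate_inj x : injective (translate x).
Proof.
move=> p q e.
have key s : (translate x s)^-1 x = diagU r (s^-1 x).
  apply: (canLR (permK _)).
  by rewrite permM permE sigma_diagU // permKV.
have e1 : p^-1 x = q^-1 x.
  by apply: (can_inj (diagUK hr)); rewrite -!key e.
by move: e; rewrite /translate e1 => /mulgI.
Qed.

Definition translation x : {perm {perm X}} := perm (@translate_inj x).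

Lemma translationE x p : translation x p = sigma_perm (p^-1 x) * p.
Proof. by rewrite permE. Qed.

(** Put u = p^-1 x and v = p^-1 y.  Translating p by x and then y gives
    p sigma_u sigma_(sigma_u^-1 v), which is symmetric in u and v: writing
    v = sigma_u z, one has sigma_v^-1 u = tau_z u, and the claim is the braid
    relation. *)
Lemma translation_comm x y : commute (translation x) (translation y).
Proof.
apply/permP=> p; rewrite !permM !translationE !invMg !permM.
set u := p^-1 x; set v := p^-1 y; rewrite !mulgA; congr (_ * p).
pose z := (sigma_perm u)^-1 v.
have vE : v = sigma r u z by rewrite -[RHS](permE (@sigma_inj u)) permKV.
have zE : (sigma_perm v)^-1 u = tau r z u.
  by apply: (canLR (permK _)); rewrite permE vE sigma_tau.
rewrite -/z zE; apply/permP=> w.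
by rewrite !permM !permE sigma_braid vE.
Qed.

(** A translate q of p by x has q^-1 x = U (p^-1 x), so that iterating
    collects the factors of sigma_(k p^-1 x) one by one. *)
Lemma translation_exp k x p :
  (translation x ^+ k) p = sigmak_perm k (p^-1 x) * p.
Proof.
elim: k p => [|k IH] p.
  by rewrite expg0 perm1; apply/permP=> y; rewrite permM permE.
rewrite expgS permM IH translationE.
set u := p^-1 x; have -> : (sigma_perm u * p)^-1 x = diagU r u.
  apply: (canLR (permK _)).
  by rewrite permM permE sigma_diagU // permKV.
by apply/permP=> y; rewrite !permM !permE.
Qed.

Lemma translations_abelian : abelian <<[set translation x | x : X]>>.
Proof.
rewrite abelian_gen; apply/centsP=> _ /imsetP[x _ ->] _ /imsetP[y _ ->].
exact: translation_comm.
Qed.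

Lemma perm_groupE (s : X * X -> X * X) (f : X -> {perm X}) :
    (forall x y, f x y = sigma s x y) ->
  perm_group s = <<[set f x | x : X]>> :> {set {perm X}}.
Proof.
move=> fE; congr <<_>>; apply/setP=> g; rewrite inE.
apply/existsP/imsetP=> [[x /forallP gx]|[x _ ->]]; exists x => //.
  by apply/permP=> y; rewrite fE; apply/eqP.
by apply/forallP=> y; rewrite fE.
Qed.

Lemma perm_group_sigma :
  perm_group r = <<[set sigma_perm x | x : X]>> :> {set _}.
Proof. by apply: perm_groupE => x y; rewrite permE. Qed.

Lemma perm_group_cabled k :
  perm_group (cabled r k) = <<[set sigmak_perm k x | x : X]>> :> {set _}.
Proof. by apply: perm_groupE => x y; rewrite permE. Qed.

(** * The cabled solution *)

Lemma sigmak_perm_in k x : sigmak_perm k x \in perm_group r.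
Proof.
elim: k x => [|k IH] x.
  suff -> : sigmak_perm 0 x = 1 by apply: group1.
  by apply/permP=> y; rewrite perm1 permE.
have -> : sigmak_perm k.+1 x = sigmak_perm k (diagU r x) * sigma_perm x.
  by apply/permP=> y; rewrite permM !permE.
by rewrite groupM // perm_group_sigma mem_gen ?imset_f.
Qed.

Lemma perm_group_cabled_sub k : perm_group (cabled r k) \subset perm_group r.
Proof.
rewrite perm_group_cabled gen_subG.
by apply/subsetP=> _ /imsetP[x _ ->]; apply: sigmak_perm_in.
Qed.

(** Both groups are the orbits of 1 under abelian groups of translations, whose
    index is controlled by [pnat_index_exp]. *)
Lemma pnat_index_cabled k :
  0 < k -> \pi(k).-nat #|perm_group r : perm_group (cabled r k)|.
Proof.
move=> k_gt0.
pose A := <<[set translation x | x : X]>>%G.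
pose B := <<[set translation x ^+ k | x : X]>>%G.
have sBA : B \subset A.
  rewrite gen_subG; apply/subsetP=> _ /imsetP[x _ ->].
  by rewrite groupX ?mem_gen ?imset_f.
apply: pnat_dvd (pnat_index_exp k_gt0 translations_abelian).
apply: (@orbit_index_dvdn _ _ 'P%act A B 1) => //.
rewrite (orbit_translations translationE).
rewrite (orbit_translations (translation_exp k)).
rewrite -perm_group_sigma -perm_group_cabled mulnC.
by rewrite Lagrange ?perm_group_cabled_sub.
Qed.

Lemma tauk_diagT k x : tauk r k x (diagT r x) = iter k (diagU r) (diagT r x).
Proof.
rewrite /tauk; elim: k x => [|k IH] x //=; rewrite tau_diagT //.
have -> : foldl (fun v u => tau r u v) x (traject (diagU r) (diagU r x) k)
    = iter k (diagU r) x by rewrite -{1}(diagUK hr x) IH diagUK.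
by rewrite -iterS iterSr diagTK.
Qed.

Lemma diagT_cabled k x : 0 < k -> diagT (cabled r k) x = iter k (diagT r) x.
Proof.
move=> k_gt0; have tau_inj := bij_inj (cabled_tau_bij hr k x).
apply: tau_inj; rewrite {1}/diagT f_finv; last first.
  exact: bij_inj (cabled_tau_bij hr k x).
rewrite /tau /= -(prednK k_gt0) /= -iterS iterSr (iter_cancel k.-1 (diagTK hr)).
rewrite tauk_diagT iterSr (diagTK hr).
by rewrite (iter_cancel k.-1 (diagUK hr)).
Qed.

Lemma dvdn_orbit_cabled k x : 0 < k ->
  max_coprime_divisor #|orbit 'P (perm_group r) x| k
    %| #|orbit 'P (perm_group (cabled r k)) x|.
Proof.
move=> k_gt0; set m := #|orbit _ (perm_group r) x|.
have m_gt0 : 0 < m by rewrite /m card_orbit indexg_gt0.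
have /andP[dvd_m co_k] := max_coprime_divisorP k m_gt0.
have := dvdn_trans dvd_m (dvdn_orbit_index 'P x (perm_group_cabled_sub k)).
rewrite Gauss_dvdr // coprime_sym.
apply: pnat_coprime (pnat_index_cabled k_gt0) _.
by rewrite -coprime_pi' 1?coprime_sym // (dvdn_gt0 m_gt0).
Qed.
End Solution.

Local Close Scope group_scope.

Theorem theorem2 (X : finType) (r : X * X -> X * X) (hr : is_solution r)
    (k : nat) (hk : 0 < k) :
  (forall x : X, diagT (cabled r k) x = iter k (diagT r) x) /\
  (forall (x : X) (m m' : nat),
     #|orbit 'P (perm_group r) x| = m ->
     #|orbit 'P (perm_group (cabled r k)) x| = m' ->
     max_coprime_divisor m k %| m').
Proof.
split=> [x|x _ _ <- <-]; first exact: diagT_cabled.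
exact: dvdn_orbit_cabled.
Qed.
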